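(* Let $n,m,c$ be natural numbers with $c\leq\min\{n,m\}+1$. Among all formal contexts with exactly $n$ objects and exactly $m$ attributes which do not contain a contranominal scale of size $c$ as a subcontext, there exists one with the maximum number of formal concepts which contains a contranominal scale of size $c-1$ as a subcontext.
   Context: A formal context is a triple $(G,M,I)$ with $I\subseteq G\times M$; its formal concepts are the pairs $(A,B)$ with $A\subseteq G$, $B\subseteq M$, $A^I=B$, $B^I=A$, where $A^I=\{n\in M:(a,n)\in I\ \forall a\in A\}$ and dually. The contranominal scale of size $j$ is the context $(\{1,\dots,j\},\{1,\dots,j\},\neq)$. A context contains a context $\mathbb{S}$ as a subcontext if for some $H\subseteq G$, $N\subseteq M$ the context $(H,N,I\cap(H\times N))$ is isomorphic to $\mathbb{S}$. *)

(* Defs.v *)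
From mathcomp Require Import all_boot.
Set Implicit Arguments.
Unset Strict Implicit.
Unset Printing Implicit Defensive.

Record context := Context {
  obj : finType;
  attr : finType;
  inc : obj -> attr -> bool
}.

Definition intent (K : context) (A : {set obj K}) : {set attr K} :=
  [set y | [forall x in A, inc x y]].

Definition extent (K : context) (B : {set attr K}) : {set obj K} :=
  [set x | [forall y in B, inc x y]].

Definition concepts (K : context) : {set {set obj K} * {set attr K}} :=
  [set p | (intent p.1 == p.2) && (extent p.2 == p.1)].

Definition contranominal (j : nat) : context :=
  @Context 'I_j 'I_j (fun i k => i != k).

Definition subcontext (K : context) (H : {set obj K}) (N : {set attr K}) :
    context :=
  @Context {x : obj K | x \in H} {y : attr K | y \in N}
    (fun x y => inc (val x) (val y)).

Definition isomorphic (K L : context) : Prop :=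
  exists (f : obj K -> obj L) (g : attr K -> attr L),
    [/\ bijective f, bijective g & forall x y, inc (f x) (g y) = inc x y].

Definition contains (K S : context) : Prop :=
  exists (H : {set obj K}) (N : {set attr K}), isomorphic (subcontext H N) S.

Definition admissible (n m c : nat) (K : context) : Prop :=
  [/\ #|obj K| = n, #|attr K| = m & ~ contains K (contranominal c)].

(* Main.v *)
(** Deleting a suitable object [g] and attribute [y] at most halves the number
    of concepts.  Given that, if a context [K] has no scale of size [j] but room
    for one, delete such [g] and [y], by induction replace the rest by a context
    with a scale of size [j - 1] (and none of size [j]) and at least as many
    concepts, and adjoin a new object and a new attribute, not incident to each
    other but incident to everything else: this doubles the number of concepts
    and increases the largest scale by exactly one.

    To find [g], fix an attribute [y] with [C := y'] not full and let [L] be the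
    family of extents that do not need [y].  Restoring [y] adds the sets
    [X :&: C] outside [L], while deleting [g] identifies exactly the pairs
    [X], [g |: X] of members of [L]; the required inequality says that at least
    as many members of [L] are unpaired as there are added sets.  It holds on
    average over [g \notin C]. *)
Require Import Defs.
From mathcomp Require Import all_boot.
From Stdlib Require Import Classical_Prop.

(** * Meet-closed families of finite sets *)

Definition unpaired (T : finType) (L : {set {set T}}) (g : T) : {set {set T}} :=
  [set A in L | (if g \in A then A :\ g else g |: A) \notin L].

(* Every [A :\ g] has two preimage slots, with and without [g]; members of [L]
   fill one each, and an unpaired [A] certifies that the other one is empty. *)
Lemma card_unpaired_le (T : finType) (L : {set {set T}}) (g : T) :
  #|L| + #|unpaired T L g| <= #|[set A :\ g | A in L]| * 2.
Proof.
pose f (b : bool) (A : {set T}) := (A :\ g, (g \in A) (+) b).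
have f_inj b : injective (f b).
  move=> A B [eqAB /addIb eq_g]; apply/setP=> x.
  have [->//|x_ng] := eqVneq x g.
  by move/setP/(_ x): eqAB; rewrite !inE x_ng.
have dis : [disjoint f false @: L & f true @: unpaired T L g].
  rewrite -setI_eq0; apply/eqP/setP=> p; rewrite !inE; apply/negP=> /andP[].
  case/imsetP=> A LA -> /imsetP[B]; rewrite inE => /andP[_ /negP nLB] [eqAB].
  rewrite addbF addbT => gAB; apply: nLB.
  suff <- : A = if g \in B then B :\ g else g |: B by [].
  apply/setP=> x; have [->|x_ng] := eqVneq x g.
    by rewrite gAB; case: ifP; rewrite !inE eqxx.
  move/setP/(_ x): eqAB; rewrite !inE x_ng /= => ->.
  by case: ifP; rewrite !inE ?x_ng ?(negbTE x_ng).
rewrite -(card_imset (mem L) (f_inj false)) -(card_imset (mem (unpaired T L g)) (f_inj true)).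
move: dis; rewrite -(leq_card_setU _ _).2 => /eqP <-.
rewrite -card_bool -cardsT -cardsX; apply/subset_leq_card/subsetP=> p.
rewrite !inE => /orP[] /imsetP[A]; rewrite ?inE.
  by move=> LA ->; rewrite andbT; apply: imset_f.
by case/andP=> LA _ ->; rewrite andbT; apply: imset_f.
Qed.

(** Double counting: [phi] injects the pairs of a point [g] outside [C] and a set in [Q] into the
    pairs of such a point and a set unpaired in its direction. *)
Lemma exists_large_unpaired (T : finType) (L : {set {set T}}) (C : {set T}) :
    setT \in L -> {in L &, forall A B, A :&: B \in L} -> C != setT ->
  exists2 g, g \notin C & #|[set A :&: C | A in L] :\: L| <= #|unpaired T L g|.
Proof.
move=> LT LI CT; set Q := _ :\: L.
(* The least member of [L] above [Y]. *)
pose cl (Y : {set T}) := \bigcap_(A in L | Y \subset A) A.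
have Lcl Y : cl Y \in L.
  by apply: (big_ind (fun A => A \in L)) => // A /andP[].
have subcl (Y : {set T}) : Y \subset cl Y by apply/bigcapsP=> A /andP[].
have clsub (Y A : {set T}) : A \in L -> Y \subset A -> cl Y \subset A.
  by move=> LA YA; apply: bigcap_inf; rewrite LA.
have clC Y : Y \in Q -> cl Y :&: C = Y.
  case/setDP=> /imsetP[A LA ->] _; apply/eqP; rewrite eqEsubset setSI ?clsub ?subsetIl //.
  by rewrite subsetI subcl subsetIr.
have QC (Y : {set T}) : Y \in Q -> Y \subset C.
  by case/setDP=> /imsetP[A _ ->] _; apply: subsetIr.
(* Otherwise [clC] gives [cl Y = Y], which puts [Y] in [L]. *)
have clQ Y : Y \in Q -> exists h, (h \in cl Y) && (h \notin C).
  move=> QY; have /subsetPn[h clh Ch] : ~~ (cl Y \subset C).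
    apply/negP=> /setIidPl eq_cl; case/setDP: QY (clC _ QY) => _ /negP nLY.
    by rewrite eq_cl => eqY; apply: nLY; rewrite -eqY.
  by exists h; rewrite clh.
(* The default [g] only makes [h] total; it is never taken for [Y] in [Q]. *)
pose h g Y := odflt g [pick h | (h \in cl Y) && (h \notin C)].
have hP g Y : Y \in Q -> (h g Y \in cl Y) && (h g Y \notin C).
  move=> /clQ[x xP]; rewrite /h; case: pickP => [//|/(_ x)].
  by rewrite xP.
(* The closure [cl Y] of an added set [Y] is usually unpaired in direction [g].
   If not, it is minimal over [Y], so [g |: cl Y] is in [L]; this set is then
   unpaired in any direction [h] in [cl Y :\: C]. *)
pose flip (p : T * {set T}) := (p.1 \notin cl p.2) && (p.1 |: cl p.2 \in L).
pose phi p := if flip p then (h p.1 p.2, p.1 |: cl p.2) else (p.1, cl p.2).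
pose Z := [set p | (p.1 \notin C) && (p.2 \in unpaired T L p.1)].
have phiZ p : p \in setX (~: C) Q -> phi p \in Z.
  case: p => g Y; rewrite in_setX in_setC /= => /andP[gC QY].
  rewrite in_set [_.2 \in _]in_set /phi; case: ifP => [|/negbT]; rewrite /flip /=.
    case/andP=> g_cl Lg; have /andP[h_cl ->] := hP g _ QY.
    rewrite Lg in_setU1 h_cl orbT /=; apply/negP=> Lh.
    (* By [Lh] this intersection is a member of [L] above [Y], so minimality of [cl Y] applies. *)
    have : h g Y \in cl Y :&: ((g |: cl Y) :\ h g Y).
      apply: (subsetP _ _ h_cl); apply: clsub; first exact: LI.
      rewrite subsetI subcl subsetD1 (subset_trans (subcl Y)) ?subsetUr //=.
      by have /andP[_] := hP g _ QY; apply: contra; apply/subsetP/QC.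
    by rewrite !inE eqxx andbF.
  rewrite gC Lcl negb_and negbK /=; case: ifP => //= g_cl _.
  apply/negP=> Lg; have : g \in cl Y :\ g.
    apply: (subsetP _ _ g_cl); apply: clsub => //.
    by rewrite subsetD1 subcl; apply: contra gC; apply/subsetP/QC.
  by rewrite !inE eqxx.
have phiC p : p \in setX (~: C) Q -> (phi p).2 :&: C = p.2.
  case: p => g Y; rewrite in_setX in_setC /= => /andP[gC QY].
  rewrite /phi; case: ifP => _ /=; rewrite ?clC // setIUl clC //.
  suff -> : [set g] :&: C = set0 by rewrite set0U.
  by apply/eqP; rewrite setI_eq0 disjoints1.
(* The trace on [C] recovers [Y]. Then the second component shows whether a point was added to
   [cl Y], and which; if none was, the first component is [g]. *)
have phi_inj : {in setX (~: C) Q &, injective phi}.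
  move=> p q Xp Xq eq_pq; have := phiC p Xp; rewrite eq_pq phiC //.
  case: p q {Xp Xq} eq_pq => [g Y] [g' Y'] /= eq_pq eqY; move: eq_pq.
  rewrite -{}eqY /phi {Y}.
  case: ifP => Fg; case: ifP => Fg' /= [].
  - move=> _ eqU; have : g \in g' |: cl Y' by rewrite -eqU setU11.
    by rewrite in_setU1 => /orP[/eqP->//|g_cl]; move: Fg; rewrite /flip /= g_cl.
  - move=> _ eqU; have := setU11 g (cl Y'); rewrite eqU.
    by case/andP: Fg => /negbTE->.
  - move=> _ eqU; have := setU11 g' (cl Y'); rewrite -eqU.
    by case/andP: Fg' => /negbTE->.
  - by move=> ->.
have leZ : #|~: C| * #|Q| <= \sum_(g in ~: C) #|unpaired T L g|.
  have -> : \sum_(g in ~: C) #|unpaired T L g| = #|Z|.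
    under eq_bigr do rewrite -sum1_card.
    rewrite pair_big_dep /= -sum1_card; apply: eq_bigl => p.
    by rewrite !inE.
  rewrite -cardsX -(card_in_imset phi_inj); apply/subset_leq_card/subsetP=> p.
  by case/imsetP=> q Xq ->; apply: phiZ.
have [/existsP[g /andP[]]|/existsPn none] :=
    boolP [exists g, (g \in ~: C) && (#|Q| <= #|unpaired T L g|)].
  by rewrite inE; exists g.
(* If every [g] fell short, the strict inequalities would add up against [leZ], unless [~: C] is
   empty. *)
have : \sum_(g in ~: C) (#|unpaired T L g|).+1 <= #|~: C| * #|Q|.
  rewrite -sum_nat_const; apply: leq_sum => g gC.
  by have := none g; rewrite gC /= -ltnNge.
under eq_bigr do rewrite -addn1.
rewrite big_split /= sum1_card => /leq_trans/(_ leZ).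
rewrite -[X in _ <= X]addn0 leq_add2l leqn0 cards_eq0 => /eqP C0.
by move: CT; rewrite -[C]setCK C0 setC0 eqxx.
Qed.

Lemma meet_closed_adjoin_le (T : finType) (L : {set {set T}}) (C : {set T}) :
    setT \in L -> {in L &, forall A B, A :&: B \in L} -> C != setT ->
  exists g, #|L :|: [set A :&: C | A in L]| <= #|[set A :\ g | A in L]| * 2.
Proof.
move=> LT LI CT; have [g _ leQ] := exists_large_unpaired T L C LT LI CT.
exists g; apply: leq_trans (card_unpaired_le T L g).
rewrite cardsU -addnBA ?subset_leq_card ?subsetIr // leq_add2l.
by rewrite setIC -cardsD.
Qed.

(** * Extents and the deletion of an object and an attribute *)

Lemma in_intent (K : context) (A : {set obj K}) y :
  (y \in intent A) = [forall x in A, inc x y].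
Proof. by rewrite inE. Qed.

Lemma in_extent (K : context) (B : {set attr K}) x :
  (x \in extent B) = [forall y in B, inc x y].
Proof. by rewrite inE. Qed.

Lemma extentU (K : context) (A B : {set attr K}) :
  extent (A :|: B) = extent A :&: extent B.
Proof.
apply/setP=> x; rewrite in_setI !in_extent; apply/forall_inP/andP=> [AB | [A_ B_] y].
  by split; apply/forall_inP=> y yAB; apply: AB; rewrite inE yAB ?orbT.
by rewrite inE => /orP[]; apply/forall_inP.
Qed.

Lemma extentK (K : context) (B : {set attr K}) :
  extent (intent (extent B)) = extent B.
Proof.
apply/setP=> x; rewrite !in_extent; apply/forall_inP/forall_inP=> xB y yB.
  apply: xB; rewrite in_intent; apply/forall_inP=> z.
  by rewrite in_extent => /forall_inP; apply.
move: yB; rewrite in_intent => /forall_inP; apply.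
by rewrite in_extent; apply/forall_inP.
Qed.

(** A concept is determined by its extent, so a single family of sets has to be counted. *)
Lemma card_concepts (K : context) :
  #|concepts K| = #|[set extent B | B : {set attr K}]|.
Proof.
rewrite -(card_in_imset (f := fst)).
  apply: eq_card => A; apply/imsetP/imsetP=> [[[A' B] + ->] | [B _ ->]] /=.
    by rewrite inE /= => /andP[_ /eqP<-]; exists B.
  exists (extent B, intent (extent B)) => //.
  by rewrite inE /= extentK !eqxx.
move=> [A B] [A' B']; rewrite !inE /= => /andP[/eqP<- _] /andP[/eqP<- _].
by move=> ->.
Qed.

(** Taking images under [val] is injective and moves extents from the sigma type to sets of objects
    of [K]. *)
Lemma card_concepts_subcontext (K : context) (H : {set obj K})
    (N : {set attr K}) :
  #|concepts (subcontext H N)| = #|[set extent B :&: H | B in powerset N]|.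
Proof.
have val_imset B : val @: extent (K := subcontext H N) B = extent (val @: B) :&: H.
  apply/setP=> x; rewrite in_setI in_extent; apply/imsetP/andP=> /=.
    case=> u; rewrite (in_extent (subcontext H N)) => /forall_inP uB ->; split; last exact: (valP u).
    by apply/forall_inP=> _ /imsetP[v vB ->]; apply: uB.
  case=> /forall_inP xB xH; exists (Sub x xH) => //.
  rewrite (in_extent (subcontext H N)); apply/forall_inP=> v vB; apply: (xB (val v)).
  exact: imset_f.
rewrite card_concepts -(card_imset _ (imset_inj val_inj)) -imset_comp.
apply: eq_card => A; apply/imsetP/imsetP=> [[B _ ->] | [B]] /=.
  exists (val @: B); last exact: val_imset.
  rewrite inE; apply/subsetP=> _ /imsetP[v _ ->]; exact: (valP v).
rewrite inE => /subsetP BN ->.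
exists [set v : attr (subcontext H N) | val v \in B] => //=.
rewrite val_imset; congr (extent _ :&: H); apply/setP=> y.
apply/idP/imsetP=> [yB | [v + ->]]; last by rewrite inE.
by exists (Sub y (BN y yB)); rewrite ?inE.
Qed.

Lemma exists_removal (K : context) : 0 < #|obj K| -> 0 < #|attr K| ->
  exists g y, #|concepts K| <= #|concepts (@subcontext K [set~ g] [set~ y])| * 2.
Proof.
move=> /card_gt0P[g0 _] /card_gt0P[y0 _].
have [/existsP[y Cy]|/existsPn full] := boolP [exists y : attr K, extent [set y] != setT].
  pose L := [set extent B | B in powerset [set~ y]].
  have LT : setT \in L.
    apply/imsetP; exists set0; first by rewrite inE sub0set.
    by apply/setP=> x; rewrite in_extent inE; apply/esym/forall_inP=> z; rewrite inE.
  have LI : {in L &, forall A B, A :&: B \in L}.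
    move=> _ _ /imsetP[A + ->] /imsetP[B + ->]; rewrite !inE => AN BN.
    by rewrite -extentU; apply: imset_f; rewrite inE subUset AN.
  have [g leg] := meet_closed_adjoin_le _ L (extent [set y]) LT LI Cy.
  exists g, y; rewrite card_concepts card_concepts_subcontext.
  suff -> : [set extent B :&: [set~ g] | B in powerset [set~ y]] = [set A :\ g | A in L].
    apply: leq_trans leg; apply/subset_leq_card/subsetP=> _ /imsetP[B _ ->].
    (* If [B] contains [y], its extent is the trace on [extent [set y]] of the extent of
       [B :\ y]. *)
    rewrite in_setU; have [yB | yB] := boolP (y \in B); apply/orP; last first.
      by left; apply: imset_f; rewrite inE subsetC sub1set inE.
    right; rewrite -(setD1K yB) extentU setIC; do 2!apply: imset_f.
    by rewrite inE subsetDr.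
  rewrite -imset_comp; apply: eq_imset => B /=.
  by rewrite setDE.
(* All columns are full, so [setT] is the only extent and any deletion works. *)
exists g0, y0; rewrite card_concepts.
apply: (@leq_trans 1); last first.
  rewrite muln_gt0 andbT card_concepts; apply/card_gt0P; exists (extent set0).
  exact: imset_f.
rewrite -(cards1 (setT : {set obj K})); apply/subset_leq_card/subsetP=> _ /imsetP[B _ ->].
rewrite inE; apply/eqP/setP=> x; rewrite in_extent inE; apply/forall_inP=> y _.
have /eqP/setP/(_ x) := negbNE (full y).
by rewrite in_extent inE => /forall_inP; apply; rewrite inE.
Qed.

(** * Direct sum with the contranominal scale of size one *)

Definition scale1_sum (K : context) : context :=
  @Context (option (obj K)) (option (attr K))
    (fun x y => match x, y with
                | Some x, Some y => inc x y
                | None, None => false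
                | _, _ => true
                end).

Lemma card_concepts_scale1_sum (K : context) :
  #|concepts K| * 2 <= #|concepts (scale1_sum K)|.
Proof.
rewrite !card_concepts -card_bool -cardsT -cardsX.
pose f (p : {set obj K} * bool) : {set obj (scale1_sum K)} :=
  [set x | if x is Some u then u \in p.1 else p.2].
have f_inj : injective f.
  move=> [A b] [A' b'] /setP eqf; congr pair; last by have := eqf None; rewrite !inE.
  by apply/setP=> x; have := eqf (Some x); rewrite !inE.
rewrite -(card_imset _ f_inj); apply/subset_leq_card/subsetP=> _ /imsetP[[A b] + ->].
rewrite in_setX => /andP[/imsetP[B _ /= ->] _]; apply/imsetP.
(* The new attribute excludes only the new object, so it is taken exactly when [None] must stay
   out. *)
exists [set y | if y is Some v then v \in B else ~~ b] => //.
apply/setP=> -[x|]; rewrite inE (in_extent (scale1_sum K)) /=; apply/idP/forall_inP.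
- by rewrite in_extent => /forall_inP xB [y|] //=; rewrite inE; apply: xB.
- move=> xB; rewrite in_extent; apply/forall_inP=> y yB.
  by apply: (xB (Some y)); rewrite inE.
- by move=> bT [y|] //=; rewrite inE bT.
- by move=> xB; apply/negPn/negP=> nb; have := xB None; rewrite inE nb => /(_ isT).
Qed.

(** Injectivity of both families follows from the relation: if [a i = a k], then [a i] is not
    incident to [b k], whence [i = k]. *)
Lemma contains_contranominalP (K : context) (j : nat) :
  contains K (contranominal j) <->
  exists (a : 'I_j -> obj K) (b : 'I_j -> attr K),
    forall i k, inc (a i) (b k) = (i != k).
Proof.
split=> [[H [N [f [g [[f' fK f'K] [g' gK g'K] fg]]]]] | [a [b ab]]].
  exists (fun i => val (f' i)), (fun k => val (g' k)) => i k.
  by have := fg (f' i) (g' k); rewrite f'K g'K /= => <-.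
have a_inj : injective a.
  by move=> i k eq_a; apply/eqP; rewrite -[_ == _]negbK -ab eq_a ab eqxx.
have b_inj : injective b.
  by move=> i k eq_b; apply/eqP; rewrite -[_ == _]negbK -ab -eq_b ab eqxx.
have bij (T : finType) (c : 'I_j -> T) : injective c ->
    exists2 f : {x : T | x \in c @: setT} -> 'I_j,
      bijective f & forall x, c (f x) = val x.
  move=> c_inj; pose h i : {x : T | x \in c @: setT} := Sub (c i) (imset_f c (in_setT i)).
  have h_inj : injective h by move=> i k /(congr1 val); apply: c_inj.
  have [f hK fK] : bijective h.
    by apply: inj_card_bij h_inj _; rewrite card_sig card_imset // cardsT.
  by exists f; [exists h | move=> x; rewrite -{2}(fK x)].
have [f f_bij fE] := bij _ _ a_inj; have [g g_bij gE] := bij _ _ b_inj.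
exists (a @: setT), (b @: setT), f, g; split=> // x y.
by rewrite /= -ab fE gE.
Qed.

Lemma contains_contranominal0 (K : context) : contains K (contranominal 0).
Proof.
by apply/contains_contranominalP; do 2![unshelve eexists; first by case] => -[].
Qed.

Lemma contains_subcontext (K : context) (H : {set obj K}) (N : {set attr K}) j :
  contains (subcontext H N) (contranominal j) -> contains K (contranominal j).
Proof.
move=> /contains_contranominalP[a [b ab]]; apply/contains_contranominalP.
by exists (fun i => val (a i)), (fun k => val (b k)).
Qed.

Lemma contains_scale1_sum (K : context) (j : nat) :
  contains (scale1_sum K) (contranominal j.+1) <-> contains K (contranominal j).
Proof.
split=> /contains_contranominalP[a [b ab]]; apply/contains_contranominalP.
  (* As [a i] and [b i] are not incident, they are [None] together, and this happens for at most one
     index. Dropping that index, or any index if there is none, leaves a scale in [K]. *)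
  have [i0 ai0] : exists i0, forall i, i != i0 -> a i <> None /\ b i <> None.
    have agree i k : a i = None -> b k = None -> i = k.
      by move=> ai bk; apply/eqP; rewrite -[_ == _]negbK -ab ai bk.
    have both i : (a i == None) = (b i == None).
      by move: (ab i i); rewrite eqxx; case: (a i); case: (b i).
    have [/existsP[i0 /eqP ai0]|/existsPn none] := boolP [exists i, a i == None].
      exists i0 => i; have bi0 : b i0 = None by apply/eqP; rewrite -both ai0.
      by move=> /eqP ii0; split=> [ai|bi]; apply: ii0; [|symmetry]; apply: agree.
    exists ord0 => i _; have := none i.
    by split; apply/eqP; rewrite -?both.
  have [a' aE] : exists a', forall i, a (lift i0 i) = Some (a' i).
    apply: (@fin_all_exists _ _ (fun i u => a (lift i0 i) = Some u)) => i.
    have [] := ai0 (lift i0 i); first by rewrite eq_sym neq_lift.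
    by case: (a _) => // u _ _; exists u.
  have [b' bE] : exists b', forall i, b (lift i0 i) = Some (b' i).
    apply: (@fin_all_exists _ _ (fun i u => b (lift i0 i) = Some u)) => i.
    have [] := ai0 (lift i0 i); first by rewrite eq_sym neq_lift.
    by case: (b _) => // u _ _; exists u.
  exists a', b' => i k.
  by have := ab (lift i0 i) (lift i0 k); rewrite aE bE (inj_eq lift_inj).
exists (fun i => omap a (unlift ord0 i)), (fun k => omap b (unlift ord0 k)).
move=> i k; case: (unliftP ord0 i) => [i' ->|->]; case: (unliftP ord0 k) => [k' ->|->] //=.
Qed.

(** * Saturation and existence of a maximum *)

Lemma exists_saturated (j : nat) (K : context) :
    j <= #|obj K| -> j <= #|attr K| -> ~ contains K (contranominal j.+1) ->
  exists K', [/\ admissible #|obj K| #|attr K| j.+1 K',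
    #|concepts K| <= #|concepts K'| & contains K' (contranominal j)].
Proof.
elim: j K => [|j IHj] K le_obj le_attr Kfree.
  by exists K; split=> //; apply: contains_contranominal0.
(* If [K] lacks this scale, so does the smaller [S], as the induction hypothesis for [j]
   requires. *)
have [Kj | Kj] := classic (contains K (contranominal j.+1)).
  by exists K.
have [||g [y le_gy]] := exists_removal K; [exact: leq_trans le_obj|exact: leq_trans le_attr|].
set S := subcontext _ _ in le_gy.
have card_S : #|obj S| = #|obj K|.-1 /\ #|attr S| = #|attr K|.-1.
  by rewrite !card_sig !cardsC1.
have [] := IHj S; first 1 last.
- by rewrite card_S.2 -ltnS prednK // (leq_trans _ le_attr).
- by move/contains_subcontext.
- move=> S' [[objS' attrS' S'free] le_S' S'j]; exists (scale1_sum S').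
  split; last exact/contains_scale1_sum.
    split; last by move/contains_scale1_sum.
      by rewrite /= card_option objS' card_S.1 prednK // (leq_trans _ le_obj).
    by rewrite /= card_option attrS' card_S.2 prednK // (leq_trans _ le_attr).
  apply: leq_trans le_gy (leq_trans _ (card_concepts_scale1_sum S')).
  by rewrite leq_mul2r le_S'.
by rewrite card_S.1 -ltnS prednK // (leq_trans _ le_obj).
Qed.

(** Induction on the bound: either it is attained or it can be lowered by one. *)
Lemma exists_maximal (T : Type) (P : T -> Prop) (f : T -> nat) (N : nat) :
    (exists x, P x) -> (forall x, P x -> f x <= N) ->
  exists2 x, P x & forall y, P y -> f y <= f x.
Proof.
move=> Pne; elim: N => [|N IHN] leN.
  by have [x Px] := Pne; exists x => // y /leN; rewrite leqn0 => /eqP->.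
have [[x [Px fx]]|none] := classic (exists x, P x /\ f x = N.+1).
  by exists x => // y /leN; rewrite fx.
apply: IHN => x Px; have := leN x Px; rewrite leq_eqVlt => /orP[/eqP fx|//].
by case: none; exists x.
Qed.

Theorem theorem5 (n m c : nat) (c_gt0 : 0 < c) (c_le : c <= (minn n m).+1) :
  exists K : context,
    [/\ admissible n m c K,
        forall L : context, admissible n m c L -> #|concepts L| <= #|concepts K|
      & contains K (contranominal c.-1)].
Proof.
case: c c_gt0 c_le => // j _; rewrite ltnS leq_min => /andP[jn jm] /=.
have [||K [objK attrK Kfree] maxK] := exists_maximal context (admissible n m j.+1)
    (fun K => #|concepts K|) (2 ^ n * 2 ^ m).
(* The full context has no non-incident pair, hence no scale of positive size. *)
- exists (@Context 'I_n 'I_m (fun _ _ => true)); split; rewrite ?card_ord //.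
  move/contains_contranominalP=> [a [b ab]]; have := ab ord0 ord0.
  by rewrite eqxx.
- move=> K [objK attrK _]; rewrite -objK -attrK -!cardsT -!card_powerset -cardsX.
  by apply/subset_leq_card/subsetP=> p _; rewrite !inE !subsetT.
(* Saturating a maximal context loses no concepts, so the result is again maximal. *)
have [||K' [K'adm leK' K'j]] := exists_saturated j K _ _ Kfree; rewrite ?objK ?attrK //.
rewrite objK attrK in K'adm.
by exists K'; split=> // L /maxK /leq_trans; apply.
Qed.
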